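(* Let $(k,X,\Omega,\mathcal{A},\mathrm{K})$ be an instance of weight-constrained anisotropic clustering, with $X=\{x_1,\dots,x_n\}$, $\Omega=\{\omega_1,\dots,\omega_n\}$. Let $(\tilde X,\tilde\Omega)$ be a weighted data set with $\tilde X=\{\tilde x_1,\dots,\tilde x_{\tilde n}\}$, $\tilde\Omega=\{\tilde\omega_1,\dots,\tilde\omega_{\tilde n}\}$, and let $p:[n]\to[\tilde n]$ be a map with $$\tilde\omega_{\tilde\jmath}=\sum_{j\in p^{-1}(\tilde\jmath)}\omega_j\qquad\forall\,\tilde\jmath\in[\tilde n].$$ Let $\epsilon\in(0,\tfrac12]$. If $$\sum_{j=1}^n\omega_j\|x_j-\tilde x_{p(j)}\|_2^2\le\frac{\epsilon^2\lambda^-(\mathcal{A})}{16\,\lambda^+(\mathcal{A})}\operatorname{OPT}(X),$$ then $(\tilde X,\tilde\Omega)$ is a linear $\epsilon$-coreset for $(k,X,\Omega,\mathcal{A},\mathrm{K})$.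
   Context: Fix $d,k\in\mathbb{N}$. A weighted data set $(X,\Omega)$ consists of a finite family $X=\{x_1,\dots,x_n\}$ of points of $\mathbb{R}^d$ (repetitions allowed) and weights $\Omega=\{\omega_1,\dots,\omega_n\}$ with $\omega_j>0$; $\omega(X)=\sum_j\omega_j$. A $k$-clustering of $(X,\Omega)$ is a vector $C=(\xi_{ij})_{i\in[k],j\in[n]}$ with $\xi_{ij}\ge0$ and $\sum_{i=1}^k\xi_{ij}=1$ for all $j$; its $i$th cluster $C_i=(\xi_{i1},\dots,\xi_{in})$ has weight $\omega(C_i)=\sum_j\xi_{ij}\omega_j$. Weight bounds are $\mathrm{K}=\{\kappa_1^-,\kappa_1^+,\dots,\kappa_k^-,\kappa_k^+\}$ with $\kappa_i^-\le\kappa_i^+$, $\kappa_i^+\in\mathbb{R}\cup\{\infty\}$; $\mathcal{C}_\mathrm{K}(k,X,\Omega)$ denotes the set of $k$-clusterings with $\kappa_i^-\le\omega(C_i)\le\kappa_i^+$ for all $i$, assumed nonempty. $\mathrm{K}_\infty$ denotes $\kappa_i^-=0,\kappa_i^+=\infty$ for all $i$. $\mathcal{A}=\{A_1,\dots,A_k\}$ is a family of symmetric positive definite $d\times d$ matrices, $\|x\|_A^2=x^\top Ax$, and $\lambda^+(\mathcal{A})$, $\lambda^-(\mathcal{A})$ are the largest and smallest eigenvalues over all matrices in $\mathcal{A}$; $\mathcal{E}$ is the family of $k$ identity matrices. For sites $S=\{s_1,\dots,s_k\}\subset\mathbb{R}^d$ and $C\in\mathcal{C}_\mathrm{K}(k,X,\Omega)$: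 $\operatorname{cost}_{\mathcal{A},\mathrm{K}}(X,C,S)=\sum_{i=1}^k\sum_{j=1}^n\xi_{ij}\omega_j\|x_j-s_i\|_{A_i}^2$; $\operatorname{cost}_{\mathcal{A},\mathrm{K}}(X,S)=\min_{C\in\mathcal{C}_\mathrm{K}(k,X,\Omega)}\operatorname{cost}_{\mathcal{A},\mathrm{K}}(X,C,S)$; $\operatorname{cost}_{\mathcal{A},\mathrm{K}}(X,C)=\min_S\operatorname{cost}_{\mathcal{A},\mathrm{K}}(X,C,S)$; $\operatorname{OPT}_{\mathcal{A},\mathrm{K}}(X)=\min_{C\in\mathcal{C}_\mathrm{K}(k,X,\Omega)}\operatorname{cost}_{\mathcal{A},\mathrm{K}}(X,C)$. $\operatorname{OPT}(X)$ denotes $\operatorname{OPT}_{\mathcal{E},\mathrm{K}_\infty}(X)$ (unconstrained Euclidean least-squares clustering). An instance of weight-constrained anisotropic clustering is a tuple $(k,X,\Omega,\mathcal{A},\mathrm{K})$. Coreset: for $\epsilon\in(0,\tfrac12]$, $\delta\in[1,\infty)$, a weighted data set $(\tilde X,\tilde\Omega)$ is an $(\epsilon,\delta)$-coreset for $(k,X,\Omega,\mathcal{A},\mathrm{K})$ if there exist a map $f:\mathcal{C}_\mathrm{K}(k,\tilde X,\tilde\Omega)\to\mathcal{C}_\mathrm{K}(k,X,\Omega)$ and reals $\Delta^+,\Delta^-$ with $0\le\Delta^+\le\delta\Delta^-$ such that for all sets $S$ of $k$ sites and all $\tilde C\in\mathcal{C}_\mathrm{K}(k,\tilde X,\tilde\Omega)$: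 (a) $(1-\epsilon)\operatorname{cost}_{\mathcal{A},\mathrm{K}}(X,f(\tilde C),S)\le\operatorname{cost}_{\mathcal{A},\mathrm{K}}(\tilde X,\tilde C,S)+\Delta^+$ and (b) $\operatorname{cost}_{\mathcal{A},\mathrm{K}}(\tilde X,S)+\Delta^-\le(1+\epsilon)\operatorname{cost}_{\mathcal{A},\mathrm{K}}(X,S)$. It is an $\epsilon$-coreset if $\delta=1$, and a linear $\epsilon$-coreset if moreover $\Delta^+=\Delta^-=0$. *)

(* Defs.v *)
From HB Require Import structures.
From mathcomp Require Import all_boot all_order all_algebra.
From mathcomp Require Import all_classical all_reals.

Set Implicit Arguments.
Unset Strict Implicit.
Unset Printing Implicit Defensive.

Import Order.TTheory GRing.Theory Num.Theory.
Local Open Scope classical_set_scope.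
Local Open Scope ring_scope.

Definition normsq (R : realType) (d : nat) (A : 'M[R]_d) (x : 'cV[R]_d) : R :=
  (x^T *m A *m x) ord0 ord0.

Definition euclid_normsq (R : realType) (d : nat) (x : 'cV[R]_d) : R :=
  \sum_(l < d) x l ord0 ^+ 2.

Definition sym_posdef (R : realType) (d : nat) (A : 'M[R]_d) : Prop :=
  A^T = A /\ forall x : 'cV[R]_d, x != 0 -> 0 < normsq A x.

(* For 0 < k, 0 < d and symmetric matrices the set of eigenvalues is finite and
   nonempty, so that sup and inf below are its maximum and minimum. *)
Definition eigenvalues (R : realType) (d k : nat) (A : 'I_k -> 'M[R]_d) : set R :=
  [set a | exists i : 'I_k, eigenvalue (A i) a].

Definition lambda_plus (R : realType) (d k : nat) (A : 'I_k -> 'M[R]_d) : R :=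
  sup (eigenvalues A).

Definition lambda_minus (R : realType) (d k : nat) (A : 'I_k -> 'M[R]_d) : R :=
  inf (eigenvalues A).

Definition cluster_weight (R : realType) (k n : nat) (w : 'I_n -> R)
    (C : 'M[R]_(k, n)) (i : 'I_k) : R :=
  \sum_(j < n) C i j * w j.

Definition clustering (R : realType) (k n : nat) (C : 'M[R]_(k, n)) : Prop :=
  (forall i j, 0 <= C i j) /\ (forall j, \sum_(i < k) C i j = 1).

(* The points do not enter the constraints: the set of admissible clusterings
   of a weighted data set depends on its weights only. *)
Definition clusterings (R : realType) (k n : nat) (w : 'I_n -> R)
    (km : 'I_k -> R) (kp : 'I_k -> \bar R) : set 'M[R]_(k, n) :=
  [set C | clustering C /\
    forall i, km i <= cluster_weight w C i /\
              ((cluster_weight w C i)%:E <= kp i)%E].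

Definition cost (R : realType) (d k n : nat) (A : 'I_k -> 'M[R]_d)
    (x : 'I_n -> 'cV[R]_d) (w : 'I_n -> R)
    (C : 'M[R]_(k, n)) (s : 'I_k -> 'cV[R]_d) : R :=
  \sum_(i < k) \sum_(j < n) C i j * w j * normsq (A i) (x j - s i).

(* The three minima below are written with inf; they are attained as soon as
   the set of admissible clusterings is nonempty: it is a compact polytope, and
   optimal sites of a fixed clustering are the centroids of its clusters. *)
Definition cost_sites (R : realType) (d k n : nat) (A : 'I_k -> 'M[R]_d)
    (km : 'I_k -> R) (kp : 'I_k -> \bar R)
    (x : 'I_n -> 'cV[R]_d) (w : 'I_n -> R) (s : 'I_k -> 'cV[R]_d) : R :=
  inf [set cost A x w C s | C in clusterings w km kp].

Definition cost_clustering (R : realType) (d k n : nat) (A : 'I_k -> 'M[R]_d)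
    (x : 'I_n -> 'cV[R]_d) (w : 'I_n -> R) (C : 'M[R]_(k, n)) : R :=
  inf [set cost A x w C s | s in [set: 'I_k -> 'cV[R]_d]].

Definition OPT (R : realType) (d k n : nat) (A : 'I_k -> 'M[R]_d)
    (km : 'I_k -> R) (kp : 'I_k -> \bar R)
    (x : 'I_n -> 'cV[R]_d) (w : 'I_n -> R) : R :=
  inf [set cost_clustering A x w C | C in clusterings w km kp].

Definition OPT_euclid (R : realType) (d k n : nat)
    (x : 'I_n -> 'cV[R]_d) (w : 'I_n -> R) : R :=
  OPT (fun _ : 'I_k => 1%:M) (fun=> 0) (fun=> +oo%E) x w.

Definition coreset_offsets (R : realType) (d k n m : nat)
    (A : 'I_k -> 'M[R]_d) (km : 'I_k -> R) (kp : 'I_k -> \bar R)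
    (x : 'I_n -> 'cV[R]_d) (w : 'I_n -> R)
    (xt : 'I_m -> 'cV[R]_d) (wt : 'I_m -> R)
    (eps delta Dp Dm : R) : Prop :=
  [/\ 0 < eps <= 2^-1, 1 <= delta, 0 <= Dp <= delta * Dm &
   exists f : 'M[R]_(k, m) -> 'M[R]_(k, n),
     set_fun (clusterings wt km kp) (clusterings w km kp) f /\
     forall (s : 'I_k -> 'cV[R]_d) (C : 'M[R]_(k, m)),
       clusterings wt km kp C ->
       (1 - eps) * cost A x w (f C) s <= cost A xt wt C s + Dp /\
       cost_sites A km kp xt wt s + Dm
         <= (1 + eps) * cost_sites A km kp x w s].

Definition coreset (R : realType) (d k n m : nat)
    (A : 'I_k -> 'M[R]_d) (km : 'I_k -> R) (kp : 'I_k -> \bar R)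
    (x : 'I_n -> 'cV[R]_d) (w : 'I_n -> R)
    (xt : 'I_m -> 'cV[R]_d) (wt : 'I_m -> R) (eps delta : R) : Prop :=
  exists Dp Dm : R, coreset_offsets A km kp x w xt wt eps delta Dp Dm.

Definition linear_coreset (R : realType) (d k n m : nat)
    (A : 'I_k -> 'M[R]_d) (km : 'I_k -> R) (kp : 'I_k -> \bar R)
    (x : 'I_n -> 'cV[R]_d) (w : 'I_n -> R)
    (xt : 'I_m -> 'cV[R]_d) (wt : 'I_m -> R) (eps : R) : Prop :=
  coreset_offsets A km kp x w xt wt eps 1 0 0.

(* Main.v *)
(** Clusterings are transported along [p] by copying the row of [p j] to [j],
    and backwards by averaging over the fibres of [p]; neither operation changes
    [sum_ij xi_ij omega_j ||xt_(p j) - s_i||^2].  It remains to compare this sum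
    with [cost x w C s].  By weighted Young inequalities with parameter
    [t = eps / 4], they differ by factors between [(1 - t)^2] and [(1 + t)^2],
    because the total movement, measured in the norms of [A], is at most
    [t^2 * lambda_minus * OPT_euclid <= t^2 * cost x w C s].
    The spectral bounds are obtained without diagonalization: if [M] is the least
    constant with [x^T A x <= M |x|^2], then [M - A] is positive semidefinite, and
    it is singular, as otherwise it would be bounded below by some [c > 0] and [M]
    could be lowered; hence [M] is an eigenvalue. *)
Require Import Defs.
From HB Require Import structures.
From mathcomp Require Import all_boot all_order all_algebra.
From mathcomp Require Import all_classical all_reals.
From mathcomp Require Import ring lra.

Set Implicit Arguments.
Unset Strict Implicit.
Unset Printing Implicit Defensive.

Import Order.TTheory GRing.Theory Num.Theory.
Local Open Scope classical_set_scope.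
Local Open Scope ring_scope.

(** * Quadratic forms and extreme eigenvalues of a symmetric matrix *)

Section QuadraticForms.
Context {R : realType} {d : nat}.
Implicit Types (A B : 'M[R]_d) (x y : 'cV[R]_d).

Lemma normsqD A B x : normsq (A + B) x = normsq A x + normsq B x.
Proof. by rewrite /normsq mulmxDr mulmxDl mxE. Qed.

Lemma normsqN A x : normsq (- A) x = - normsq A x.
Proof. by rewrite /normsq mulmxN mulNmx mxE. Qed.

Lemma normsq_scalar a x : normsq a%:M x = a * euclid_normsq x.
Proof.
rewrite /normsq mul_mx_scalar -scalemxAl mxE [in LHS]mxE /euclid_normsq.
by congr (_ * _); apply: eq_bigr => l _; rewrite mxE expr2.
Qed.

Lemma normsq1 x : normsq 1%:M x = euclid_normsq x.
Proof. by rewrite normsq_scalar mul1r. Qed.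

Lemma normsqDZ A a x y : A^T = A ->
  normsq A (x + a *: y) =
    normsq A x + 2 * a * (x^T *m A *m y) 0 0 + a ^+ 2 * normsq A y.
Proof.
move=> symA; have tr : (y^T *m A *m x) 0 0 = (x^T *m A *m y) 0 0.
  transitivity ((y^T *m A *m x)^T 0 0); first by rewrite [RHS]mxE.
  by rewrite !trmx_mul trmxK symA mulmxA.
have addE (M N : 'M[R]_1) : (M + N) 0 0 = M 0 0 + N 0 0 by rewrite mxE.
have scaleE b (M : 'M[R]_1) : (b *: M) 0 0 = b * M 0 0 by rewrite mxE.
have trD : (x + a *: y)^T = x^T + a *: y^T by apply/matrixP => i j; rewrite !mxE.
rewrite /normsq trD !mulmxDl !mulmxDr.
rewrite -!scalemxAl -!scalemxAr.
by rewrite !addE !scaleE tr; ring.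
Qed.

Lemma euclid_normsq_ge0 x : 0 <= euclid_normsq x.
Proof. by apply: sumr_ge0 => l _; exact: sqr_ge0. Qed.

Lemma euclid_normsq_eq0 x : (euclid_normsq x == 0) = (x == 0).
Proof.
apply/idP/eqP => [|->]; last first.
  by rewrite /euclid_normsq big1 // => l _; rewrite mxE expr0n.
rewrite /euclid_normsq psumr_eq0 => [/allP x0|l _]; last exact: sqr_ge0.
apply/matrixP => l j; rewrite ord1 mxE; apply/eqP.
by rewrite -sqrf_eq0; apply: x0; rewrite mem_index_enum.
Qed.

Lemma euclid_normsq_gt0 x : (0 < euclid_normsq x) = (x != 0).
Proof. by rewrite lt0r euclid_normsq_eq0 euclid_normsq_ge0 andbT. Qed.

Lemma normsq_bounded A : exists K, forall x, normsq A x <= K * euclid_normsq x.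
Proof.
exists (\sum_i \sum_j `|A j i|) => x.
rewrite /normsq mxE mulr_suml; apply: ler_sum => i _.
rewrite mxE !mulr_suml; apply: ler_sum => j _; rewrite mxE.
have sq l : x l 0 ^+ 2 <= euclid_normsq x.
  rewrite /euclid_normsq (bigD1 l) //= lerDl.
  by apply: sumr_ge0 => l' _; exact: sqr_ge0.
have prod_le : `|x j 0 * x i 0| <= euclid_normsq x.
  have := sq i; have := sq j; have := sqr_ge0 (x i 0 - x j 0).
  have := sqr_ge0 (x i 0 + x j 0); rewrite ler_norml => *; apply/andP; split; nra.
apply: le_trans (ler_wpM2l (normr_ge0 _) prod_le).
by rewrite -normrM; apply: le_trans (ler_norm _); rewrite mulrAC mulrC mulrA.
Qed.

(** Expand the form at [x - K^-1 B^-1 x], where [K > 0] bounds the form of [invmx B]: the cross term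
    contributes [-2 K^-1 |x|^2] and the last term at most [K^-1 |x|^2], so [c = K^-1] works. *)
Lemma psd_unitmx_coercive B : B^T = B -> B \in unitmx ->
    (forall x, 0 <= normsq B x) ->
  exists2 c, 0 < c & forall x, c * euclid_normsq x <= normsq B x.
Proof.
move=> symB unitB psdB; have [K0 hK0] := normsq_bounded (invmx B).
pose K := `|K0| + 1; have Kgt0 : 0 < K by rewrite ltr_wpDl.
exists K^-1 => [|x]; first by rewrite invr_gt0.
pose y := invmx B *m x.
have xBy : (x^T *m B *m y) 0 0 = euclid_normsq x.
  by rewrite -normsq1 /normsq mulmx1 -mulmxA mulKVmx.
have qy : normsq B y <= K * euclid_normsq x.
  have -> : normsq B y = normsq (invmx B) x.
    by rewrite /normsq -mulmxA mulKVmx // trmx_mul trmx_inv symB.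
  apply: le_trans (hK0 x) _; apply: ler_wpM2r; first exact: euclid_normsq_ge0.
  by have := ler_norm K0; rewrite /K; lra.
have := psdB (x + - K^-1 *: y); rewrite normsqDZ // xBy.
have : K^-1 ^+ 2 * normsq B y <= K^-1 * euclid_normsq x.
  apply: le_trans (ler_wpM2l (sqr_ge0 _) qy) _.
  by rewrite expr2 !mulrA -[_ * _ * K]mulrA mulVf ?gt_eqF // mulr1.
rewrite sqrrN; lra.
Qed.

Lemma symmetric_max_eigenvalue A : (0 < d)%N -> A^T = A ->
  exists2 a, eigenvalue A a & forall x, normsq A x <= a * euclid_normsq x.
Proof.
move=> d_gt0 symA.
pose U := [set K | forall x, normsq A x <= K * euclid_normsq x].
have rayleigh_lb x : x != 0 -> lbound U (normsq A x / euclid_normsq x).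
  by move=> x0 K /(_ x); rewrite ler_pdivrMr // euclid_normsq_gt0.
(* A nonzero vector bounds [U] below; for [d = 0] every real number would lie in [U]. *)
have [e e0] : exists e : 'cV[R]_d, e != 0.
  exists (const_mx 1); apply/eqP => /matrixP/(_ (Ordinal d_gt0) 0).
  by rewrite !mxE => /eqP; rewrite oner_eq0.
have U0 : U !=set0 by exact: normsq_bounded.
have Uinf : has_inf U.
  by split=> //; exists (normsq A e / euclid_normsq e); exact: rayleigh_lb.
have UM : U (inf U).
  move=> x; have [->|x0] := eqVneq x 0.
    have /eqP -> : euclid_normsq (0 : 'cV[R]_d) == 0 by rewrite euclid_normsq_eq0.
    by rewrite /normsq mulmx0 mxE mulr0.
  rewrite -ler_pdivrMr ?euclid_normsq_gt0 //.
  by apply: lb_le_inf => //; exact: rayleigh_lb.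
exists (inf U) => //; pose B := (inf U)%:M - A.
have qB x : normsq B x = inf U * euclid_normsq x - normsq A x.
  by rewrite normsqD normsqN normsq_scalar.
have [/psd_unitmx_coercive coercive|singB] := boolP (B \in unitmx).
  have [||c c_gt0 hc] := coercive.
  - by rewrite linearB /= tr_scalar_mx symA.
  - by move=> x; rewrite qB subr_ge0; exact: UM.
  suff /(ge_inf Uinf.2) : U (inf U - c) by lra.
  by move=> x; have := hc x; rewrite qB; lra.
(* The eigenspace for [inf U] is the kernel of [A - (inf U)%:M], which is [- B]. *)
rewrite /eigenvalue /eigenspace kermx_eq0 row_free_unit.
by rewrite -opprB -scaleN1r unitmxZ ?unitrN1.
Qed.

Lemma symmetric_min_eigenvalue A : (0 < d)%N -> A^T = A ->
  exists2 a, eigenvalue A a & forall x, a * euclid_normsq x <= normsq A x.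
Proof.
move=> d_gt0 symA.
have [||a /eigenvalueP[v vA v0] ha] := @symmetric_max_eigenvalue (- A) => //.
  by rewrite linearN /= symA.
exists (- a) => [|x]; last by have := ha x; rewrite normsqN; lra.
by apply/eigenvalueP; exists v => //; rewrite scaleNr -vA mulmxN opprK.
Qed.

Lemma eigenvalue_normsq A a : eigenvalue A a ->
  exists2 x, x != 0 & normsq A x = a * euclid_normsq x.
Proof.
case/eigenvalueP => v vA v0; exists v^T; first by rewrite trmx_eq0.
by rewrite -normsq_scalar /normsq trmxK vA mul_mx_scalar.
Qed.

(** The form is nonnegative at [x + s t^-1 y] for [s = 1] and [s = -1]; multiplied by [t], this
    bounds the cross term from both sides. *)
Lemma normsqD_young A (t : R) x y : A^T = A -> (forall z, 0 <= normsq A z) -> 0 < t ->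
  (1 - t) * normsq A x - (t^-1 - 1) * normsq A y <= normsq A (x + y)
    <= (1 + t) * normsq A x + (1 + t^-1) * normsq A y.
Proof.
move=> symA psdA t_gt0.
have -> : normsq A (x + y) = normsq A x + 2 * (x^T *m A *m y) 0 0 + normsq A y.
  by rewrite -[y in LHS]scale1r normsqDZ // expr1n mul1r mulr1.
have cross s : s ^+ 2 = 1 ->
    0 <= t * normsq A x + 2 * s * (x^T *m A *m y) 0 0 + t^-1 * normsq A y.
  move=> s2; rewrite [leRHS](_ : _ = t * normsq A (x + (s * t^-1) *: y)).
    by rewrite mulr_ge0 // ltW.
  by rewrite normsqDZ // exprMn s2; field; rewrite gt_eqF.
have := cross 1 (expr1n _ _); have := cross (-1) (sqrr_sign _ 1).
by move=> *; apply/andP; split; lra.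
Qed.

End QuadraticForms.

(** * Spectral bounds for a family of positive definite matrices *)

Section PosdefFamily.
Context {R : realType} {d k : nat} (A : 'I_k -> 'M[R]_d).
Hypotheses (d_gt0 : (0 < d)%N) (posdefA : forall i, sym_posdef (A i)).

Lemma posdef_ge0 i x : 0 <= normsq (A i) x.
Proof.
have [->|x0] := eqVneq x 0; first by rewrite /normsq mulmx0 mxE.
by apply: ltW; exact: (posdefA i).2.
Qed.

Lemma posdef_eigenvalue_gt0 a : eigenvalues A a -> 0 < a.
Proof.
case=> i /eigenvalue_normsq[x x0 qx].
by have := (posdefA i).2 x x0; rewrite qx pmulr_lgt0 // euclid_normsq_gt0.
Qed.

(** Ensures that [sup] dominates every eigenvalue. An eigenvalue of [A i] is a Rayleigh quotient,
    hence at most [K i], and the sum of the [|K i|] serves all [i] at once. *)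
Lemma eigenvalues_has_ubound : has_ubound (eigenvalues A).
Proof.
have /choice[K hK] i : exists K, forall x, normsq (A i) x <= K * euclid_normsq x.
  exact: normsq_bounded.
exists (\sum_i `|K i|) => a [i /eigenvalue_normsq[x x0 qx]].
have : a <= K i.
  by rewrite -(ler_pM2r (_ : 0 < euclid_normsq x)) ?euclid_normsq_gt0 // -qx.
move=> /le_trans; apply; apply: le_trans (ler_norm _) _.
by rewrite (bigD1 i) //= lerDl sumr_ge0.
Qed.

Lemma eigenvalues_has_lbound : has_lbound (eigenvalues A).
Proof. by exists 0 => a /posdef_eigenvalue_gt0/ltW. Qed.

Lemma normsq_le_lambda_plus i x :
  normsq (A i) x <= lambda_plus A * euclid_normsq x.
Proof.
have [a ha hq] := symmetric_max_eigenvalue d_gt0 (posdefA i).1.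
apply: le_trans (hq x) _; apply: ler_wpM2r; first exact: euclid_normsq_ge0.
by apply: ub_le_sup; [exact: eigenvalues_has_ubound|exists i].
Qed.

Lemma lambda_minus_le_normsq i x :
  lambda_minus A * euclid_normsq x <= normsq (A i) x.
Proof.
have [a ha hq] := symmetric_min_eigenvalue d_gt0 (posdefA i).1.
apply: le_trans (hq x); apply: ler_wpM2r; first exact: euclid_normsq_ge0.
by apply: ge_inf; [exact: eigenvalues_has_lbound|exists i].
Qed.

Lemma lambda_plus_gt0 : (0 < k)%N -> 0 < lambda_plus A.
Proof.
move=> k_gt0; pose i := Ordinal k_gt0.
have [a ha _] := symmetric_max_eigenvalue d_gt0 (posdefA i).1.
have aA : eigenvalues A a by exists i.
apply: lt_le_trans (posdef_eigenvalue_gt0 aA) _.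
by apply: ub_le_sup => //; exact: eigenvalues_has_ubound.
Qed.

(** The weak sign suffices for multiplying inequalities by [lambda_minus A], and it follows without
    the infimum being attained. *)
Lemma lambda_minus_ge0 : (0 < k)%N -> 0 <= lambda_minus A.
Proof.
move=> k_gt0; pose i := Ordinal k_gt0.
have [a ha _] := symmetric_min_eigenvalue d_gt0 (posdefA i).1.
by apply: lb_le_inf => [|b /posdef_eigenvalue_gt0/ltW //]; exists a, i.
Qed.

End PosdefFamily.

(** * Estimates for the clustering cost *)

Section Costs.
Context {R : realType} {d k n : nat}.
Implicit Types (A : 'I_k -> 'M[R]_d) (x y : 'I_n -> 'cV[R]_d).
Implicit Types (w : 'I_n -> R) (C : 'M[R]_(k, n)) (s : 'I_k -> 'cV[R]_d).

Lemma cost_ge0 A x w C s : (forall i z, 0 <= normsq (A i) z) ->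
  (forall j, 0 <= w j) -> clustering C -> 0 <= cost A x w C s.
Proof.
move=> psdA w0 [C0 _]; apply: sumr_ge0 => i _; apply: sumr_ge0 => j _.
by rewrite !mulr_ge0.
Qed.

(** With bounds [0] and [+oo] every clustering is admissible, so one found under other weight bounds
    competes here too. Nonnegative costs keep both nested infima bounded below. *)
Lemma OPT_euclid_le x w C s : (forall j, 0 <= w j) -> clustering C ->
  OPT_euclid k x w <= cost (fun=> 1%:M) x w C s.
Proof.
move=> w0 clC.
have psd1 (i : 'I_k) (z : 'cV[R]_d) : 0 <= normsq 1%:M z.
  by rewrite normsq1 euclid_normsq_ge0.
have cost0 C' s' : clustering C' -> 0 <= cost (fun=> 1%:M) x w C' s'.
  by move=> clC'; apply: cost_ge0.
apply: (@le_trans _ _ (cost_clustering (fun=> 1%:M) x w C)).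
  apply: ge_inf.
    exists 0 => _ [C' [clC' _] <-]; apply: lb_le_inf; last by move=> _ [s' _ <-]; exact: cost0.
    by exists (cost (fun=> 1%:M) x w C' s), s.
  exists C => //; split=> // i; split; last by rewrite leey.
  by apply: sumr_ge0 => j _; rewrite mulr_ge0 //; case: clC.
by apply: ge_inf; [exists 0 => _ [s' _ <-]; exact: cost0|exists s].
Qed.

Lemma cost_euclid_le A x w C s : (0 < d)%N -> (forall i, sym_posdef (A i)) ->
  (forall j, 0 <= w j) -> clustering C ->
  lambda_minus A * cost (fun=> 1%:M) x w C s <= cost A x w C s.
Proof.
move=> d_gt0 posdefA w0 [C0 _]; rewrite mulr_sumr; apply: ler_sum => i _.
rewrite mulr_sumr; apply: ler_sum => j _; rewrite normsq1 mulrCA.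
by apply: ler_wpM2l; [rewrite mulr_ge0|exact: lambda_minus_le_normsq].
Qed.

(** Each column of [C] sums to 1, so splitting a point among clusters costs nothing extra and the
    bound does not depend on [C]. *)
Lemma movement_le A x y w C : (0 < d)%N -> (forall i, sym_posdef (A i)) ->
  (forall j, 0 <= w j) -> clustering C ->
  \sum_i \sum_j C i j * w j * normsq (A i) (y j - x j) <=
    lambda_plus A * \sum_j w j * euclid_normsq (x j - y j).
Proof.
move=> d_gt0 posdefA w0 [C0 C1]; rewrite exchange_big mulr_sumr /=.
apply: ler_sum => j _.
rewrite -[leRHS]mul1r -(C1 j) mulr_suml; apply: ler_sum => i _.
have -> : euclid_normsq (x j - y j) = euclid_normsq (y j - x j).
  by apply: eq_bigr => l _; rewrite !mxE -sqrrN opprB.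
rewrite -mulrA; apply: ler_wpM2l => //; rewrite mulrCA.
by apply: ler_wpM2l => //; exact: normsq_le_lambda_plus.
Qed.

(** Young's inequality for [x j - s i] and [y j - x j], weighted by [C i j * w j] and summed. *)
Lemma cost_young A x y w C s (t D : R) : (forall i, sym_posdef (A i)) ->
    (forall j, 0 <= w j) -> clustering C -> 0 < t ->
    D = \sum_i \sum_j C i j * w j * normsq (A i) (y j - x j) ->
  (1 - t) * cost A x w C s - (t^-1 - 1) * D <= cost A y w C s
    <= (1 + t) * cost A x w C s + (1 + t^-1) * D.
Proof.
move=> posdefA w0 [C0 _] t_gt0 ->.
have young i j := @normsqD_young _ _ _ t (x j - s i) (y j - x j)
  (posdefA i).1 (posdef_ge0 posdefA i) t_gt0.
have split_y i j : x j - s i + (y j - x j) = y j - s i.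
  by rewrite addrC addrA subrK.
have Cw0 i j : 0 <= C i j * w j by rewrite mulr_ge0.
apply/andP; split; rewrite /cost !mulr_sumr -?sumrB -?big_split /=.
  apply: ler_sum => i _; rewrite !mulr_sumr -sumrB; apply: ler_sum => j _.
  have /andP[+ _] := young i j; rewrite split_y => /(ler_wpM2l (Cw0 i j)).
  by apply: le_trans; rewrite le_eqVlt; apply/orP; left; apply/eqP; ring.
apply: ler_sum => i _; rewrite !mulr_sumr -big_split /=; apply: ler_sum => j _.
have /andP[_] := young i j; rewrite split_y => /(ler_wpM2l (Cw0 i j)).
by move=> /le_trans; apply; rewrite le_eqVlt; apply/orP; left; apply/eqP; ring.
Qed.

End Costs.

(** * Transport of clusterings along [p] *)

Section Fibres.
Context {R : realType} {d k n m : nat} (w : 'I_n -> R) (wt : 'I_m -> R).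
Context (p : 'I_n -> 'I_m).
Hypothesis fibre_weight : forall jt, wt jt = \sum_(j < n | p j == jt) w j.

Definition pull_clustering (C : 'M[R]_(k, m)) : 'M[R]_(k, n) :=
  \matrix_(i, j) C i (p j).

Definition push_clustering (C : 'M[R]_(k, n)) : 'M[R]_(k, m) :=
  \matrix_(i, jt) ((\sum_(j < n | p j == jt) C i j * w j) / wt jt).

(** The test function [g] serves two purposes: [g = 1] gives cluster weights, and the squared
    distance to a site gives costs. *)
Lemma sum_pull_clustering C (g : 'I_m -> R) i :
  \sum_j pull_clustering C i j * w j * g (p j) = \sum_jt C i jt * wt jt * g jt.
Proof.
rewrite (partition_big p predT) //=; apply: eq_bigr => jt _.
rewrite fibre_weight mulr_sumr mulr_suml; apply: eq_bigr => j /eqP <-.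
by rewrite mxE.
Qed.

Lemma sum_push_clustering C (g : 'I_m -> R) i : (forall jt, 0 < wt jt) ->
  \sum_jt push_clustering C i jt * wt jt * g jt = \sum_j C i j * w j * g (p j).
Proof.
move=> wt0; rewrite [RHS](partition_big p predT) //=; apply: eq_bigr => jt _.
rewrite mxE divfK ?gt_eqF // mulr_suml.
by apply: eq_bigr => j /eqP <-.
Qed.

Lemma pull_clusterings km kp :
  set_fun (clusterings wt km kp) (clusterings w km kp) pull_clustering.
Proof.
move=> C [[C0 C1] CK]; split.
  split=> [i j|j]; first by rewrite mxE.
  by rewrite -(C1 (p j)); apply: eq_bigr => i _; rewrite mxE.
move=> i; have -> : cluster_weight w (pull_clustering C) i = cluster_weight wt C i.
  have := sum_pull_clustering C (fun=> 1) i.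
  by under eq_bigr do rewrite mulr1; under [RHS]eq_bigr do rewrite mulr1.
exact: CK.
Qed.

Lemma push_clusterings km kp : (forall j, 0 <= w j) -> (forall jt, 0 < wt jt) ->
  set_fun (clusterings w km kp) (clusterings wt km kp) push_clustering.
Proof.
move=> w0 wt0 C [[C0 C1] CK]; split.
  split=> [i jt|jt].
    rewrite mxE; apply: divr_ge0; last exact: ltW.
    by apply: sumr_ge0 => j _; rewrite mulr_ge0.
  under eq_bigr do rewrite mxE.
  rewrite -mulr_suml exchange_big /=.
  under eq_bigr do rewrite -mulr_suml C1 mul1r.
  (* The column sum is the fibre weight over [wt jt]; positivity of [wt] excludes empty fibres. *)
  by rewrite -fibre_weight mulfV ?gt_eqF.
move=> i; have -> : cluster_weight wt (push_clustering C) i = cluster_weight w C i.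
  have := sum_push_clustering C (fun=> 1) i wt0.
  by under eq_bigr do rewrite mulr1; under [RHS]eq_bigr do rewrite mulr1.
exact: CK.
Qed.

Lemma cost_pull_clustering (A : 'I_k -> 'M[R]_d) xt C s :
  cost A (xt \o p) w (pull_clustering C) s = cost A xt wt C s.
Proof.
by apply: eq_bigr => i _;
  exact: (sum_pull_clustering C (fun jt => normsq (A i) (xt jt - s i))).
Qed.

Lemma cost_push_clustering (A : 'I_k -> 'M[R]_d) xt C s :
  (forall jt, 0 < wt jt) ->
  cost A xt wt (push_clustering C) s = cost A (xt \o p) w C s.
Proof.
move=> wt0; apply: eq_bigr => i _.
exact: (sum_push_clustering C (fun jt => normsq (A i) (xt jt - s i)) i wt0).
Qed.

End Fibres.

(** * The two coreset inequalities *)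

Theorem theorem2p2 (R : realType) (d k n m : nat) (hd : (0 < d)%N) (hk : (0 < k)%N)
    (x : 'I_n -> 'cV[R]_d) (w : 'I_n -> R) (hw : forall j, 0 < w j)
    (A : 'I_k -> 'M[R]_d) (hA : forall i, sym_posdef (A i))
    (km : 'I_k -> R) (kp : 'I_k -> \bar R)
    (hK : forall i, ((km i)%:E <= kp i)%E)
    (hne : clusterings w km kp !=set0)
    (xt : 'I_m -> 'cV[R]_d) (wt : 'I_m -> R) (hwt : forall jt, 0 < wt jt)
    (p : 'I_n -> 'I_m)
    (hp : forall jt, wt jt = \sum_(j < n | p j == jt) w j)
    (eps : R) (heps : 0 < eps <= 2^-1)
    (hmov : \sum_(j < n) w j * euclid_normsq (x j - xt (p j))
       <= eps ^+ 2 * lambda_minus A / (16 * lambda_plus A) * OPT_euclid k x w) :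
  linear_coreset A km kp x w xt wt eps.
Proof.
have w0 j : 0 <= w j by exact: ltW.
have psdA := posdef_ge0 hA.
have [eps_gt0 eps_le] := andP heps.
(* The 16 in [hmov] is the square of this 4. The resulting factors satisfy
   [(1 + t)^2 <= 1 + 4 t = 1 + eps] and [(1 - t)^2 >= 1 - eps]. *)
pose t := eps / 4; have t_gt0 : 0 < t by rewrite /t; lra.
have moved C s : clustering C ->
    (1 - eps) * cost A x w C s <= cost A (xt \o p) w C s
      <= (1 + eps) * cost A x w C s.
  move=> clC; set a := cost A x w C s.
  have a_ge0 : 0 <= a by exact: cost_ge0.
  set D := \sum_i \sum_j C i j * w j * normsq (A i) ((xt \o p) j - x j).
  have D_le : D <= t ^+ 2 * a.
    apply: le_trans (movement_le _ _ hd hA w0 clC) _.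
    have lp := lambda_plus_gt0 hd hA hk.
    apply: le_trans (ler_wpM2l (ltW lp) hmov) _.
    have -> : lambda_plus A *
        (eps ^+ 2 * lambda_minus A / (16 * lambda_plus A) * OPT_euclid k x w) =
        t ^+ 2 * (lambda_minus A * OPT_euclid k x w).
      by rewrite /t; field; rewrite gt_eqF.
    apply: ler_wpM2l; first exact: sqr_ge0.
    apply: le_trans (cost_euclid_le _ _ hd hA w0 clC).
    by apply: ler_wpM2l; [exact: lambda_minus_ge0|exact: OPT_euclid_le].
  have /andP[lo up] := @cost_young _ _ _ _ A x (xt \o p) w C s t D hA w0 clC t_gt0 erefl.
  have tV : t^-1 * (t ^+ 2 * a) = t * a by field; rewrite gt_eqF.
  (* Makes the coefficient [t^-1 - 1] nonnegative, so that the upper bound on [D] can enter the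
     lower estimate. *)
  have tV1 : 1 <= t^-1 by rewrite invf_ge1 // /t; lra.
  have eps_t : eps = 4 * t by rewrite /t; field.
  have t2a : t ^+ 2 * a <= t * a by apply: ler_wpM2r => //; rewrite /t; nra.
  have ta : 0 <= t * a by rewrite mulr_ge0 // ltW.
  apply/andP; split.
    apply: le_trans lo; rewrite -/a.
    have : (t^-1 - 1) * D <= (t^-1 - 1) * (t ^+ 2 * a).
      by apply: ler_wpM2l => //; rewrite subr_ge0.
    have := sqr_ge0 t; rewrite eps_t => *; nra.
  apply: le_trans up _; rewrite -/a.
  have : (1 + t^-1) * D <= (1 + t^-1) * (t ^+ 2 * a).
    by apply: ler_wpM2l => //; lra.
  by rewrite eps_t; lra.
split=> //; first by rewrite mulr0 lexx.
(* Pulling back preserves the cost at the points [xt (p j)], so (a) is the lower half of [moved]. *)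
exists (pull_clustering p); split; first exact: pull_clusterings.
move=> s C hC; rewrite !addr0; split.
  have [clC _] := pull_clusterings hp hC.
  by rewrite -(cost_pull_clustering hp); case/andP: (moved _ s clC).
(* Dividing by [1 + eps] turns (b) into a lower bound for an infimum, to be checked at each
   admissible [C']; the pushed [C'] competes in the infimum for [xt]. *)
rewrite mulrC -ler_pdivrMr; last by lra.
apply: lb_le_inf; first by case: hne => C' hC'; exists (cost A x w C' s), C'.
move=> _ [C' hC' <-]; rewrite ler_pdivrMr; last by lra.
rewrite mulrC; case/andP: (moved C' s hC'.1) => _; apply: le_trans.
rewrite -(cost_push_clustering w p A xt C' s hwt); apply: ge_inf.
  by exists 0 => _ [C'' [clC'' _] <-]; apply: cost_ge0 => // jt; exact: ltW.
by exists (push_clustering w wt p C') => //; exact: push_clusterings.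
Qed.
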